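(* Let $\langle u_n\rangle_{n=1}^{\infty}$ be a subadditive sequence of real numbers. Then there exists a continuous, almost everywhere differentiable, subadditive function $f:[1,\infty)\to\mathbb{R}$ such that $f(n)=u_n$ for all $n\in\mathbb{N}$. Conversely, if $f:[1,\infty)\to\mathbb{R}$ is a subadditive function, then $\langle f(n)\rangle_{n=1}^{\infty}$ is a subadditive sequence.
   Context: $\mathbb{N}=\{1,2,3,\dots\}$. A real sequence $\langle u_n\rangle_{n=1}^{\infty}$ is subadditive if $u_{m+n}\le u_m+u_n$ for all $m,n\in\mathbb{N}$. A function $f:I\to\mathbb{R}$, $I\subseteq\mathbb{R}$, is subadditive if $f(x+y)\le f(x)+f(y)$ for all $x,y\in I$ with $x+y\in I$. *)

(* Defs.v *)
From mathcomp Require Import all_boot all_order all_algebra.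
From mathcomp Require Import all_classical all_reals all_analysis.
Set Implicit Arguments.
Unset Strict Implicit.
Unset Printing Implicit Defensive.
Import Order.TTheory GRing.Theory Num.Theory.
Import numFieldNormedType.Exports.
Local Open Scope classical_set_scope.
Local Open Scope ring_scope.

(* Sequences are indexed by the positive integers: the value [u 0] is junk
   and is never constrained. *)
Definition subadditive_seq (R : realType) (u : nat -> R) : Prop :=
  forall m n : nat, (0 < m)%N -> (0 < n)%N -> u (m + n)%N <= u m + u n.

(* A function with domain [I] is encoded by a total function whose values
   outside [I] are junk. *)
Definition subadditive_on (R : realType) (I : set R) (f : R -> R) : Prop :=
  forall x y : R, I x -> I y -> I (x + y) -> f (x + y) <= f x + f y.

(* Lebesgue-almost every point of [I] is a point of differentiability. For an
   interval [I], the junk values of [f] outside [I] can only affect this at the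
   endpoints of [I], which form a null set. *)
Definition ae_differentiable_on (R : realType) (I : set R) (f : R -> R) : Prop :=
  {ae (@lebesgue_measure R), forall x : R, I x -> derivable f x 1}.

(* Main.v *)
Require Import Defs.
From mathcomp Require Import all_boot all_order all_algebra.
From mathcomp Require Import all_classical all_reals all_analysis.
From mathcomp Require Import ring lra.
Import Order.TTheory GRing.Theory Num.Theory.
Import numFieldNormedType.Exports.
Local Open Scope classical_set_scope.
Local Open Scope ring_scope.

(* The interpolating function is the piecewise linear one. If x = m + s and
   y = n + t with s, t in [0, 1], then on each of the two triangles cut out of
   the unit square by s + t = 1 the same barycentric weights express both
   f (x + y) and f x + f y: the former averages the values u (i + j), the latter
   the values u i + u j, over the vertices (i, j) of the triangle. Subadditivity
   of u at the vertices therefore gives subadditivity of f. *)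

Definition interpolation {R : realType} (u : nat -> R) (x : R) : R :=
  let n := Num.truncn x in u n + (x - n%:R) * (u n.+1 - u n).

(** Consecutive affine pieces agree at the integer where they meet, so the formula of the [n]-th
    piece stays valid at [n.+1%:R], where [Num.truncn] has already jumped. *)
Lemma interpolationE (R : realType) (u : nat -> R) (n : nat) (x : R) :
  n%:R <= x <= n.+1%:R ->
  interpolation u x = u n + (x - n%:R) * (u n.+1 - u n).
Proof.
move=> /andP[nx]; rewrite le_eqVlt => /orP[/eqP ->|xn]; rewrite /interpolation.
  by rewrite natrK -[n.+1]addn1 natrD; ring.
by rewrite (@truncn_def _ x n) // nx xn.
Qed.

Lemma interpolation_nat (R : realType) (u : nat -> R) (n : nat) :
  interpolation u n%:R = u n.
Proof. by rewrite /interpolation natrK subrr mul0r addr0. Qed.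

Lemma continuous_at_interpolation (R : realType) (u : nat -> R) (x : R) :
  0 < x -> {for x, continuous (interpolation u)}.
Proof.
move=> x0.
(* An open window of length 2 has [x] in its interior even when [x] is an integer, and contains only
   one breakpoint, [n.+1%:R]. *)
have [n /andP[nx xn]] : exists n : nat, n%:R < x < n.+2%:R.
  have := truncn_itv (ltW x0); case: (Num.truncn x) => [|n] /andP[nx xn].
    by exists 0%N; rewrite x0 (lt_trans xn) // ltr_nat.
  by exists n; rewrite xn (lt_le_trans _ nx) // ltr_nat.
pose t (y : R) := y - n.+1%:R.
(* The absolute value merges the two affine pieces meeting at n + 1. *)
pose g (y : R) := u n.+1 + t y * ((u n.+2 - u n) / 2)
  + `|t y| * ((u n.+2 - u n.+1 *+ 2 + u n) / 2).
have gE : {near x, g =1 interpolation u}.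
  near=> y.
  have ny : n%:R < y by near: y; exact: lt_nbhsr.
  have yn : y < n.+2%:R by near: y; exact: lt_nbhsl.
  have n1 : n.+1%:R = n%:R + 1 :> R by rewrite -addn1 natrD.
  have [yl|yr] := leP y n.+1%:R.
    rewrite /g /t (@interpolationE _ u n) ?(ltW ny) //.
    by rewrite ler0_norm ?subr_le0 // n1; field.
  rewrite /g /t (@interpolationE _ u n.+1) ?(ltW yr) ?(ltW yn) //.
  by rewrite gtr0_norm ?subr_gt0 // n1; field.
have tx : t y @[y --> x] --> t x by apply: cvgB; [exact: cvg_id|exact: cvg_cst].
have gx : g y @[y --> x] --> g x.
  apply: cvgD; [apply: cvgD|]; first exact: cvg_cst.
    by apply: cvgM => //; exact: cvg_cst.
  by apply: cvgM; [exact: cvg_norm|exact: cvg_cst].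
have gxE : g x = interpolation u x := nbhs_singleton gE.
by rewrite gxE in gx; apply: cvg_trans gx; exact: near_eq_cvg.
Unshelve. all: by end_near. Qed.

Lemma derivable_interpolation (R : realType) (u : nat -> R) (x : R) :
  0 < x -> (forall n : nat, x != n%:R) -> derivable (interpolation u) x 1.
Proof.
move=> x0 xN; have /andP[nx xn] := truncn_itv (ltW x0).
set n := Num.truncn x in nx xn.
apply: (@near_eq_derivable _ _ _
  (fun y : R => u n + (y - n%:R) * (u n.+1 - u n))); last first.
  by apply: ex_derive.
near=> y; rewrite (@interpolationE _ u n) //.
apply/andP; split; apply: ltW; near: y.
  by apply: lt_nbhsr; rewrite lt_neqAle eq_sym xN.
exact: lt_nbhsl.
Unshelve. all: by end_near. Qed.

(** Corners can occur only at integers, which form a countable, hence Lebesgue-null, set. *)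
Lemma ae_differentiable_interpolation (R : realType) (u : nat -> R) (I : set R) :
  I `<=` `]0, +oo[ -> ae_differentiable_on I (interpolation u).
Proof.
move=> I0; exists (range (fun n : nat => n%:R : R)).
have cN : countable (range (fun n : nat => n%:R : R)) by exact: card_image_le.
split; first exact: countable_measurable.
  exact: countable_lebesgue_measure0.
move=> x /= /not_implyP[Ix]; apply: contra_notP => xN.
apply: derivable_interpolation.
  by have := I0 x Ix; rewrite /= in_itv /= andbT.
by move=> n; apply/eqP => xn; apply: xN; exists n.
Qed.

Lemma subadditive_interpolation (R : realType) (u : nat -> R) :
  subadditive_seq u -> subadditive_on `[1, +oo[ (interpolation u).
Proof.
move=> uS x y; rewrite /= !in_itv /= !andbT => x1 y1 _.
have /andP[mx xm] := truncn_itv (le_trans ler01 x1).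
have /andP[ny yn] := truncn_itv (le_trans ler01 y1).
(* Positivity of both integer parts keeps the junk value [u 0] out of every use of [uS]. *)
have m0 : (0 < Num.truncn x)%N by rewrite truncn_gt_nat.
have n0 : (0 < Num.truncn y)%N by rewrite truncn_gt_nat.
rewrite {2 3}/interpolation.
move: (Num.truncn x) (Num.truncn y) => m n in mx xm ny yn m0 n0 *.
have mS : m.+1%:R = m%:R + 1 :> R by rewrite -addn1 natrD.
have nS : n.+1%:R = n%:R + 1 :> R by rewrite -addn1 natrD.
have mnD : (m + n)%:R = m%:R + n%:R :> R by rewrite natrD.
have mnS : (m + n).+1%:R = m%:R + n%:R + 1 :> R by rewrite -addn1 !natrD.
have mnSS : (m + n).+2%:R = m%:R + n%:R + 2 :> R by rewrite -addn2 !natrD.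
(* These two vertices span the diagonal shared by both triangles. *)
have h10 := uS m.+1 n isT n0; rewrite addSn in h10.
have h01 := uS m n.+1 m0 isT; rewrite addnS in h01.
rewrite mS in xm; rewrite nS in yn.
have [st|st] := leP (x + y) (m + n).+1%:R; rewrite mnS in st.
  have h00 := uS m n m0 n0.
  rewrite (@interpolationE _ u (m + n)); last first.
    by apply/andP; split; rewrite ?mnD ?mnS; lra.
  rewrite mnD.
  (* With [s = x - m] and [t = y - n], the weights [1 - s - t], [s], [t] are the barycentric
     coordinates of [(s, t)] for the vertices [(0, 0)], [(1, 0)], [(0, 1)]; the goal is the sum of
     the weighted inequalities. *)
  have := ler_wpM2l (_ : 0 <= 1 - (x - m%:R) - (y - n%:R)) h00.
  have := ler_wpM2l (_ : 0 <= x - m%:R) h10.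
  have := ler_wpM2l (_ : 0 <= y - n%:R) h01.
  move=> /(_ ltac:(lra)) k1 /(_ ltac:(lra)) k2 /(_ ltac:(lra)) k3; nra.
have h11 := uS m.+1 n.+1 isT isT; rewrite addSn addnS in h11.
rewrite (@interpolationE _ u (m + n).+1); last first.
  by apply/andP; split; rewrite ?mnSS ?mnS; lra.
rewrite mnS.
(* For the vertices [(1, 1)], [(1, 0)], [(0, 1)] the barycentric coordinates are [s + t - 1],
   [1 - t], [1 - s]. *)
have := ler_wpM2l (_ : 0 <= (x - m%:R) + (y - n%:R) - 1) h11.
have := ler_wpM2l (_ : 0 <= 1 - (y - n%:R)) h10.
have := ler_wpM2l (_ : 0 <= 1 - (x - m%:R)) h01.
move=> /(_ ltac:(lra)) k1 /(_ ltac:(lra)) k2 /(_ ltac:(lra)) k3; nra.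
Qed.

Theorem theorem2p1 (R : realType) :
  (forall u : nat -> R, subadditive_seq u ->
    exists f : R -> R,
      [/\ {within `[1, +oo[, continuous f},
          ae_differentiable_on `[1, +oo[ f,
          subadditive_on `[1, +oo[ f
        & forall n : nat, (0 < n)%N -> f n%:R = u n]) /\
  (forall f : R -> R, subadditive_on `[1, +oo[ f ->
    subadditive_seq (fun n : nat => f n%:R)).
Proof.
split=> [u uS|f fS m n m0 n0]; last first.
  by rewrite natrD; apply: fS; rewrite /= in_itv /= andbT -?natrD ler1n ?addn_gt0 ?m0.
exists (interpolation u); split.
(* Continuity is two-sided even at 1: whatever [u 0] is, the piece to the left of 1 ends at
   [u 1]. *)
- apply: continuous_in_subspaceT => x; rewrite inE /= in_itv /= andbT => x1.
  exact: continuous_at_interpolation (lt_le_trans ltr01 x1).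
- apply: ae_differentiable_interpolation => x; rewrite /= !in_itv /= !andbT.
  exact: lt_le_trans.
- exact: subadditive_interpolation.
- by move=> n _; exact: interpolation_nat.
Qed.
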